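(* There exists a constant $c$ such that for every integer $d \ge 2$, the $d$-dimensional hypercube $H_d$ satisfies $\mathrm{cub}(H_d) \le \frac{c\,d}{\log d}$.
   Context: The $d$-dimensional hypercube $H_d$ is the graph whose vertices correspond to the $2^d$ binary strings of length $d$, two vertices being adjacent if and only if the corresponding strings differ in exactly one bit position. A $k$-dimensional (axis-parallel) cube is a Cartesian product $R_1 \times R_2 \times \cdots \times R_k$ where each $R_i$ is a closed interval of the form $[a_i, a_i+1]$ on the real line. A finite simple graph $G$ is representable as the intersection graph of a family of sets $(S_x)_{x \in V(G)}$ if two distinct vertices $x,y$ are adjacent in $G$ if and only if $S_x \cap S_y \neq \emptyset$. The cubicity $\mathrm{cub}(G)$ is the minimum $k$ such that $G$ is representable as the intersection graph of axis-parallel cubes in $k$-dimensional space. *)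

(* Defs.v *)
From HB Require Import structures.
From mathcomp Require Import all_boot all_order all_algebra.
From mathcomp Require Import all_classical all_reals.
From mathcomp Require Import lra.

Set Implicit Arguments.
Unset Strict Implicit.
Unset Printing Implicit Defensive.

Import Order.TTheory GRing.Theory Num.Theory.

Local Open Scope classical_set_scope.
Local Open Scope ring_scope.

Record sgraph := SGraph {
  vertex :> finType;
  adj : rel vertex;
  adj_sym : symmetric adj;
  adj_irrefl : irreflexive adj
}.

Definition differ_in_one_bit (d : nat) (x y : d.-tuple bool) : bool :=
  #|[set i : 'I_d | tnth x i != tnth y i]%SET| == 1%N.

Lemma differ_in_one_bit_sym (d : nat) : symmetric (@differ_in_one_bit d).
Proof.
by move=> x y; congr (_ == _); apply: eq_card => i; rewrite !inE eq_sym.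
Qed.

Lemma differ_in_one_bit_irrefl (d : nat) : irreflexive (@differ_in_one_bit d).
Proof.
move=> x; rewrite /differ_in_one_bit (_ : [set i | _]%SET = finset.set0).
  by rewrite cards0.
by apply/setP => i; rewrite !inE eqxx.
Qed.

Definition hypercube (d : nat) : sgraph :=
  SGraph (@differ_in_one_bit_sym d) (@differ_in_one_bit_irrefl d).

Definition is_cube (R : realType) (k : nat) (C : set 'rV[R]_k) : Prop :=
  exists a : 'rV[R]_k,
    C = [set p : 'rV[R]_k |
          forall i, p ord0 i \in `[a ord0 i, a ord0 i + 1]].

Definition intersection_representation (G : sgraph) (T : Type)
    (S : G -> set T) : Prop :=
  forall x y : G, x != y -> (adj x y <-> S x `&` S y !=set0).

(* For k = 0 the only cube is the one-point space, so complete graphs (and the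
   empty graph) have cubicity 0. *)
Definition cube_representable (R : realType) (G : sgraph) (k : nat) : Prop :=
  exists S : G -> set 'rV[R]_k,
    (forall x, is_cube (S x)) /\ intersection_representation S.

(* One coordinate per vertex v, whose intervals start at 0 for v, at 1 for the
   neighbours of v and at 2 for all other vertices. *)
Lemma cube_representable_card (R : realType) (G : sgraph) :
  cube_representable R G #|G|.
Proof.
pose g (v x : G) : R := if x == v then 0 else if adj v x then 1 else 2.
pose a (x : G) : 'rV[R]_#|G| := \row_i g (enum_val i) x.
exists (fun x => [set p : 'rV[R]_#|G| |
  forall i, p ord0 i \in `[a x ord0 i, a x ord0 i + 1]]).
split=> [x|x y neq_xy]; first by exists (a x).
split=> [xy|[p [/= px py]]].
- exists (\row_i Num.max (a x ord0 i) (a y ord0 i)); split=> i;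
    rewrite /= in_itv /= !mxE le_max lexx ?orbT /= ge_max /g;
    set v := enum_val i;
    case: (eqVneq x v) => [xv|_]; case: (eqVneq y v) => [yv|_];
    rewrite -?xv -?yv ?xy ?[adj y x]adj_sym ?xy;
    repeat case: ifP => ?; apply/andP; split; lra.
- apply/negPn/negP => nxy.
  have := px (enum_rank x); have := py (enum_rank x).
  rewrite /= !in_itv /= !mxE enum_rankK /g eqxx eq_sym (negPf neq_xy).
  by rewrite (negPf nxy) => /andP[? _] /andP[_ ?]; lra.
Qed.

Lemma ex_cube_representable (R : realType) (G : sgraph) :
  exists k, `[< cube_representable R G k >].
Proof. by exists #|G|; apply/asboolP/cube_representable_card. Qed.

Definition cubicity (R : realType) (G : sgraph) : nat :=
  ex_minn (ex_cube_representable R G).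

(* Main.v *)
(* An integer matrix N with entries in {-1, 0, 1} gives one unit interval
   starting at (N x)_i per row i and per 0/1 vector x, and the cubes of adjacent
   vertices always meet.  The cubes of the other pairs are disjoint as soon as
   N z has an entry of absolute value at least 2 for every z in {-1, 0, 1}^d
   with at least two nonzero entries.  Such an N with O(d / log d) rows is
   built by doubling d, from sign matrices P with O(d / log d) rows such that
   P z = 0 only for z = 0; the latter come from the coin-weighing recursion of
   Cantor and Mills. *)
Require Import Defs.
From mathcomp Require Import all_boot all_order all_algebra.
From mathcomp Require Import all_classical all_reals.
From mathcomp Require Import exp.
From mathcomp Require Import zify lra.

Set Implicit Arguments.
Unset Strict Implicit.
Unset Printing Implicit Defensive.

Import Order.TTheory GRing.Theory Num.Theory.
Local Open Scope classical_set_scope.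
Local Open Scope ring_scope.

(** * Matrices with entries in {-1, 0, 1} and coin weighing *)

Definition ternary {m n} (A : 'M[int]_(m, n)) : Prop :=
  forall i j, `|A i j| <= 1.

(** Vectors with entries in {-1, 0, 1} are the differences of 0/1 vectors, so such an [M] tells 0/1
    vectors apart, as in coin weighing. *)
Definition detecting {r n} (M : 'M[int]_(r, n)) : Prop :=
  forall z : 'cV_n, ternary z -> M *m z = 0 -> z = 0.

(** When [z] is the difference of two vertices of the hypercube, the conclusion says that they are
    equal or adjacent. *)
Definition separating {k n} (N : 'M[int]_(k, n)) : Prop :=
  forall z : 'cV_n, ternary z -> ternary (N *m z) ->
    forall i j, z i 0 != 0 -> z j 0 != 0 -> i = j.

Lemma ternary_col_mx m1 m2 n (A : 'M[int]_(m1, n)) (B : 'M_(m2, n)) :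
  ternary (col_mx A B) <-> ternary A /\ ternary B.
Proof.
split=> [tAB|[tA tB] i j]; last by rewrite mxE; case: splitP.
by split=> i j; [rewrite -(col_mxEu A B)|rewrite -(col_mxEd A B)].
Qed.

Lemma ternary_row_mx m n1 n2 (A : 'M[int]_(m, n1)) (B : 'M_(m, n2)) :
  ternary (row_mx A B) <-> ternary A /\ ternary B.
Proof.
split=> [tAB|[tA tB] i j]; last by rewrite mxE; case: splitP.
by split=> i j; [rewrite -(row_mxEl A B)|rewrite -(row_mxEr A B)].
Qed.

Lemma ternary0 m n : ternary (0 : 'M[int]_(m, n)).
Proof. by move=> i j; rewrite mxE. Qed.

Lemma ternaryN m n (A : 'M[int]_(m, n)) : ternary A -> ternary (- A).
Proof. by move=> tA i j; rewrite mxE normrN. Qed.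

Lemma ternary1 n : ternary (1%:M : 'M[int]_n).
Proof. by move=> i j; rewrite mxE; case: (_ == _). Qed.

(* The top rows force [t = - 2 M x], hence [t = 0] for entries in {-1, 0, 1}. *)
Lemma detecting_step r n (M : 'M[int]_(r, n)) : detecting M ->
  detecting (block_mx (row_mx M M) 1%:M (row_mx M (- M)) 0).
Proof.
move=> dM z; rewrite -[z]vsubmxK -[usubmx z]vsubmxK.
move: (usubmx (usubmx z)) (dsubmx (usubmx z)) (dsubmx z) => x y t.
rewrite !ternary_col_mx => -[[tx ty] tt].
rewrite mul_block_col !mul_row_col mul1mx mul0mx addr0 mulNmx -col_mx0.
move=> /eq_col_mx[+ /subr0_eq xy]; rewrite -xy => sum0.
have [x0 t0] : M *m x = 0 /\ t = 0.
  move: (M *m x) sum0 => u sum0; split; apply/matrixP => i j;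
    by move/matrixP/(_ i j): sum0; have := tt i j; rewrite !mxE;
    move: (u i j) (t i j) => ? ?; lia.
by rewrite t0 (dM x) // (dM y) -?xy // !col_mx0.
Qed.

Lemma exists_detecting m :
  exists M : 'M[int]_(2 ^ m.+1, 2 ^ m * (m + 3)), ternary M /\ detecting M.
Proof.
suff step r n (M : 'M[int]_(r, n)) : ternary M -> detecting M ->
    exists M' : 'M[int]_(r + r, n + n + r), ternary M' /\ detecting M'.
  elim: m => [|m [M [tM dM]]].
    (* The base case, of size 2 by 3, is [step] applied to the 1 by 1 identity. *)
    have [|z _|M' []] := step 1 1 1%:M; first exact: ternary1.
      by rewrite mul1mx.
    by exists M'.
  have [M' HM'] := step _ _ M tM dM.
  have <- : (2 ^ m.+1 + 2 ^ m.+1 = 2 ^ m.+2)%N by rewrite [RHS]expnS mul2n addnn.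
  suff <- : (2 ^ m * (m + 3) + 2 ^ m * (m + 3) + 2 ^ m.+1 =
             2 ^ m.+1 * (m.+1 + 3))%N by exists M'.
  by rewrite expnS; lia.
move=> tM dM; exists (block_mx (row_mx M M) 1%:M (row_mx M (- M)) 0).
split; last exact: detecting_step.
rewrite ternary_col_mx !ternary_row_mx; do ![split=> //].
- exact: ternary1.
- exact: ternaryN.
- exact: ternary0.
Qed.

Lemma mulmx_pad r n m (M : 'M[int]_(r, n + m)) (z : 'cV_n) :
  M *m col_mx z 0 = lsubmx M *m z.
Proof. by rewrite -{1}[M]hsubmxK mul_row_col mulmx0 addr0. Qed.

Lemma exists_sign_detecting m n : (n <= 2 ^ m * (m + 3))%N ->
  exists P : 'M[int]_(2 ^ m.+2, n), (forall i j, `|P i j| = 1) /\ detecting P.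
Proof.
move=> le_n; have [M [tM dM]] := exists_detecting m.
move: M tM dM; rewrite -(subnKC le_n); move: (_ - n)%N => q M tM dM.
have {q M tM dM} [M [tM dM]] :
    exists M : 'M[int]_(2 ^ m.+1, n), ternary M /\ detecting M.
  exists (lsubmx M); split=> [i j|z tz Mz]; first by rewrite mxE.
  have /dM : ternary (col_mx z (0 : 'cV_q)).
    by apply/ternary_col_mx; split=> //; exact: ternary0.
  by rewrite mulmx_pad => /(_ Mz); rewrite -col_mx0 => /eq_col_mx[].
(* Both [M + F] and [M - F] are sign matrices, and they add up to [2 M]. *)
pose F := \matrix_(i, j) (1 - `|M i j|).
have -> : (2 ^ m.+2 = 2 ^ m.+1 + 2 ^ m.+1)%N by rewrite expnS mul2n addnn.
exists (col_mx (M + F) (M - F)); split=> [i j|z tz].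
  by rewrite mxE; case: splitP => k _; rewrite !mxE; have := tM k j;
    move: (M k j) => ?; lia.
rewrite mul_col_mx -col_mx0 => /eq_col_mx[]; rewrite mulmxDl mulmxBl.
move=> zD zB; apply: dM => //; move: (M *m z) (F *m z) zD zB => u v zD zB.
apply/matrixP => i j; move/matrixP/(_ i j): zD.
move/matrixP/(_ i j): zB; rewrite !mxE.
by move: (u i j) (v i j) => ? ?; lia.
Qed.

(** * Parity and the doubling of separating matrices *)

(** Signs are odd, so all entries of [P *m z] share the parity of the sum of the entries of [z]. *)
Lemma mulmx_sign_parity p n (P : 'M[int]_(p, n)) (z : 'cV_n) i :
  (forall i j, `|P i j| = 1) ->
  exists q : int, (P *m z) i 0 = \sum_j z j 0 + 2 * q.
Proof.
move=> P1; rewrite mxE.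
elim/big_rec2: _ => [|j s _ _ [q ->]]; first by exists 0.
have [Pij|Pij] : P i j = 1 \/ P i j = -1 by have := P1 i j; lia.
- by exists q; rewrite Pij; lia.
- by exists (q - z j 0); rewrite Pij; lia.
Qed.

(* If both halves [x], [y] of a vector are nonzero, either the sum of the
   entries of one half is even, or that of the whole vector is; on even sums
   a sign matrix takes even values, so it detects with values at least [2]. *)
Lemma separating_double k p n (N : 'M[int]_(k, n)) (P : 'M[int]_(p, n)) :
  separating N -> (forall i j, `|P i j| = 1) -> detecting P ->
  separating (col_mx (row_mx N N)
                     (col_mx (block_mx P P P (- P)) (block_mx P 0 0 P))).
Proof.
move=> sN P1 dP z; rewrite -[z]vsubmxK.
move: (usubmx z) (dsubmx z) => x y; rewrite ternary_col_mx => -[tx ty].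
rewrite !mul_col_mx !mul_row_col !ternary_col_mx.
rewrite !mul0mx addr0 add0r mulNmx => -[tN [[tD tB] [tPx tPy]]].
have [x0|y0] : x = 0 \/ y = 0.
  have parity u i := mulmx_sign_parity u i P1.
  have [sx|sx] := boolP (2 %| \sum_j x j 0)%Z.
    left; apply: dP => //; apply/matrixP => i j; rewrite ord1 [RHS]mxE.
    have := tPx i 0; have [q] := parity x i.
    by move: ((P *m x) i 0) (\sum_j _) sx => ? ?; lia.
  have [sy|sy] := boolP (2 %| \sum_j y j 0)%Z.
    right; apply: dP => //; apply/matrixP => i j; rewrite ord1 [RHS]mxE.
    have := tPy i 0; have [q] := parity y i.
    by move: ((P *m y) i 0) (\sum_j _) sy => ? ?; lia.
  (* Both sums are odd, so [P *m x + P *m y] and [P *m x - P *m y] have even entries of absolute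
     value at most 1; both vanish, and hence so does [P *m x]. *)
  left; apply: dP => //; apply/matrixP => i j; rewrite ord1 [RHS]mxE.
  have [q] := parity x i; have [q'] := parity y i.
  have := tD i 0; have := tB i 0.
  move: (P *m x) (P *m y) => u v; rewrite !mxE.
  move: (u i 0) (v i 0) (\sum_j x j 0) (\sum_j y j 0) sx sy.
  by move=> ? ? ? ?; lia.
(* All nonzero entries lie in one half, on which [row_mx N N] acts as [N]. *)
- move: tN; rewrite x0 mulmx0 add0r => tN i j.
  rewrite !mxE; case: splitP => [? _|i' ii']; first by rewrite mxE eqxx.
  case: splitP => [? _|j' jj']; first by rewrite mxE eqxx.
  by move=> zi zj; apply: val_inj; rewrite /= ii' jj' (sN y ty tN i' j').
- move: tN; rewrite y0 mulmx0 addr0 => tN i j.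
  rewrite !mxE; case: splitP => [i' ii'|? _]; last by rewrite mxE eqxx.
  case: splitP => [j' jj'|? _]; last by rewrite mxE eqxx.
  by move=> zi zj; apply: val_inj; rewrite /= ii' jj' (sN x tx tN i' j').
Qed.

(** * Row counts of order [2 ^ j / j] *)

Lemma exists_sign_detecting_pow2 j :
  exists p (P : 'M[int]_(p, 2 ^ j)),
    [/\ (p * (j + 3) <= 16 * 2 ^ j)%N, forall i k, `|P i k| = 1 & detecting P].
Proof.
have /andP[] :
    (2 ^ trunc_log 2 (j + 3) <= j + 3 < 2 ^ (trunc_log 2 (j + 3)).+1)%N.
  by apply: trunc_log_bounds; rewrite ?addn3.
have : (0 < trunc_log 2 (j + 3))%N by apply: trunc_log_max; rewrite ?addn3.
case: trunc_log => // l _; rewrite !expnS => le_l lt_l.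
have l_lt := ltn_expl l (isT : 1 < 2)%N.
have le_lj : (l <= j)%N by lia.
have ej : (2 ^ j = 2 ^ (j - l) * 2 ^ l)%N by rewrite -expnD subnK.
(* Since [2 * 2 ^ l <= j + 3] and [l < 2 ^ l], the choice [m = j - l] gives [2 ^ l <= m + 3], hence
   enough columns. The constant 16 comes from [4 * 2 ^ (j - l)] rows and [j + 3 < 4 * 2 ^ l]. *)
have [|P [P1 dP]] := @exists_sign_detecting (j - l) (2 ^ j).
  by rewrite ej leq_mul2l; apply/orP; right; lia.
exists (2 ^ (j - l).+2)%N, P; split=> //; rewrite !expnS ej; nia.
Qed.

Lemma exists_separating_pow2 j :
  exists k (N : 'M[int]_(k, 2 ^ j)),
    [/\ (k * (j + 3) <= 128 * 2 ^ j)%N, ternary N & separating N].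
Proof.
elim: j => [|j [k [N [le_k tN sN]]]].
  exists 0%N, 0; split=> //; first exact: ternary0.
  by move=> z _ _ i i' _ _; rewrite !ord1.
have [p [P [le_p P1 dP]]] := exists_sign_detecting_pow2 j.
have tP : ternary P by move=> i i'; rewrite P1.
have -> : (2 ^ j.+1 = 2 ^ j + 2 ^ j)%N by rewrite expnS mul2n addnn.
exists (k + (p + p + (p + p)))%N; eexists; split; last first.
- exact: separating_double sN P1 dP.
- rewrite !(ternary_col_mx, ternary_row_mx).
  by do ![split=> //]; try exact: ternaryN; exact: ternary0.
(* Here [(k + 4 * p) * (j + 3) <= (128 + 64) * 2 ^ j], and [j + 4 <= 4 / 3 * (j + 3)] raises 192 to
   256 = 2 * 128. *)
- by nia.
Qed.

Lemma exists_separating n j : (n <= 2 ^ j)%N ->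
  exists k (N : 'M[int]_(k, n)),
    [/\ (k * (j + 3) <= 128 * 2 ^ j)%N, ternary N & separating N].
Proof.
move=> le_n; have [k [N [le_k tN sN]]] := exists_separating_pow2 j.
exists k; move: N tN sN; rewrite -{1 2 3}(subnKC le_n).
move: (_ - n)%N => q N tN sN; exists (lsubmx N).
split=> // [i i'|z tz tNz i i' zi zi']; first by rewrite mxE.
apply: (@lshift_inj n q); apply: (sN (col_mx z 0)); rewrite ?col_mxEu //.
  by apply/ternary_col_mx; split=> //; exact: ternary0.
by rewrite mulmx_pad.
Qed.

(** * From matrices to cubes *)

Lemma unit_intervals_meet (R : realType) k (a b : 'rV[R]_k) :
  [set p : 'rV[R]_k | forall i, p ord0 i \in `[a ord0 i, a ord0 i + 1]] `&`
  [set p : 'rV[R]_k | forall i, p ord0 i \in `[b ord0 i, b ord0 i + 1]]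
     !=set0 <->
  forall i, `|a ord0 i - b ord0 i| <= 1.
Proof.
split=> [[p [/= pa pb]] i|ab].
  move: (pa i) (pb i); rewrite !in_itv /= => /andP[? ?] /andP[? ?].
  by rewrite ler_norml; apply/andP; split; lra.
exists (\row_i Num.max (a ord0 i) (b ord0 i)); split=> i /=;
  rewrite in_itv /= mxE le_max lexx ?orbT /= ge_max;
  by have := ab i; rewrite ler_norml => /andP[? ?]; apply/andP; split; lra.
Qed.

Lemma cube_representable_hypercube (R : realType) k d (N : 'M[int]_(k, d)) :
  ternary N -> separating N -> cube_representable R (hypercube d) k.
Proof.
move=> tN sN.
pose bits (x : d.-tuple bool) : 'cV[int]_d := \col_i (tnth x i)%:Z.
pose a x : 'rV[R]_k := \row_i ((N *m bits x) i 0)%:~R.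
exists (fun x => [set p : 'rV[R]_k |
  forall i, p ord0 i \in `[a x ord0 i, a x ord0 i + 1]]).
split=> [x|x y neq_xy]; first by exists (a x).
rewrite unit_intervals_meet.
have aB i : (`|a x ord0 i - a y ord0 i| <= 1) =
            (`|(N *m (bits x - bits y)) i 0| <= 1).
  have -> : a x ord0 i - a y ord0 i = ((N *m (bits x - bits y)) i 0)%:~R.
    by rewrite mulmxBr [in LHS]mxE [X in _ - X]mxE -intrB !mxE.
  by rewrite -intr_norm lerz1.
have zE i : (bits x - bits y) i 0 = (tnth x i)%:Z - (tnth y i)%:Z.
  by rewrite !mxE.
have tz : ternary (bits x - bits y).
  by move=> i j; rewrite ord1 zE; case: (tnth x i); case: (tnth y i).
have z0 i : ((bits x - bits y) i 0 != 0) = (tnth x i != tnth y i).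
  by rewrite zE; case: (tnth x i); case: (tnth y i).
(* If a single bit differs, [N *m (bits x - bits y)] is a column of [N] up to sign. *)
rewrite /= /differ_in_one_bit; split=> [/finset.cards1P[j xyj] i|xy].
  rewrite aB mxE (bigD1 j) //= big1 ?addr0 => [|l lj].
    by rewrite normrM mulr_ile1.
  have : l \notin [set j]%SET by rewrite finset.inE.
  by rewrite -xyj finset.inE -z0 negbK => /eqP ->; rewrite mulr0.
(* [sN] only yields at most one differing bit; that there is one follows from [x != y]. *)
have [j xyj] : exists j, tnth x j != tnth y j.
  apply/existsP; rewrite -fintype.negb_forall; apply: contra_neqN neq_xy.
  by move=> /forallP xy'; apply: eq_from_tnth => j; apply/eqP.
apply/finset.cards1P; exists j; apply/setP => l; rewrite !finset.inE.
apply/idP/eqP => [xyl|->//]; apply: (sN _ tz); rewrite ?z0 //.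
by move=> i i'; rewrite ord1 -aB.
Qed.

Theorem theorem1 (R : realType) :
  exists c : R, forall d : nat, (2 <= d)%N ->
    (cubicity R (hypercube d))%:R <= c * d%:R / ln (d%:R : R).
Proof.
(* With [2 ^ j < d <= 2 ^ j.+1], the row count satisfies [k * (j + 4) <= 128 * 2 ^ j.+1 < 256 * d],
   while [ln d <= j + 1] because [ln 2 <= 1]. *)
exists 256 => d d2.
have d0 : 0 < d%:R :> R by rewrite ltr0n; lia.
have ln_d : 0 < ln (d%:R : R) by rewrite ln_gt0 // ltr1n.
have /andP[lt_d le_d] := up_log_bounds (isT : 1 < 2)%N d2.
have j0 : (0 < up_log 2 d)%N by rewrite up_log_gt0.
move: j0 lt_d le_d; case: (up_log 2 d) => // j _ /= lt_d le_d.
have [k [N [le_k tN sN]]] := exists_separating le_d.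
have le_cub : (cubicity R (hypercube d) <= k)%N.
  rewrite /cubicity; case: ex_minnP => m _; apply.
  by apply/asboolP; exact: cube_representable_hypercube tN sN.
have ln_le : ln (d%:R : R) <= j.+1%:R.
  apply: (@le_trans _ _ (ln (2 ^+ j.+1))).
    by rewrite ler_ln ?posrE ?exprn_gt0 // -natrX ler_nat.
  rewrite lnXn //; apply: ler_wMn2r.
  by apply: (@le_ln1Dx R 1); lra.
rewrite ler_pdivlMr //; apply: (@le_trans _ _ (k%:R * j.+1%:R)).
  by apply: ler_pM => //; [exact: ltW|rewrite ler_nat].
rewrite -!natrM ler_nat; move: le_k lt_d; rewrite expnS; nia.
Qed.
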